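(* Let $K \geq 2$ be an integer and let $\epsilon > 0$ be sufficiently small. Then there exists $x_0 = x_0(K,\epsilon)$ such that for every $x \geq x_0$ there exist at least $x^{1-\epsilon}$ integers $n \in [x, (1+K^{-1})x]$ such that $$\omega(nj + a^h k) \geq (\log\log\log x)^{\frac{1}{3}-\epsilon} \quad\text{and}\quad \omega(nj - a^h k) \geq (\log\log\log x)^{\frac{1}{3}-\epsilon}$$ for all integers $2 \leq a \leq K$, $1 \leq j, k \leq K$ and $0 \leq h \leq K\log x$.
   Context: $\omega(m)$ denotes the number of distinct prime factors of the integer $m$ (applied to $|m|$ if $m<0$). *)

(* Defs.v *)
From Stdlib Require Import Reals ZArith Znumtheory List.
Import ListNotations.

(* omega m = number of distinct prime factors of |m|.
   Convention: omega 0 = 0 (primes are counted up to |m|). *)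
Definition omega (m : Z) : nat :=
  length (filter (fun p => if prime_dec p then Z.eqb (Z.rem m p) 0 else false)
                 (map Z.of_nat (seq 0 (S (Z.to_nat (Z.abs m)))))).

(* Main.v *)
(** For a base [a] and a prime [q] dividing [a^d - 1], fixing [n] modulo [q] so
    that [q] divides [n j + a^b k] makes [q] divide [n j + a^h k] for every
    [h = b mod d]: one prime serves a proportion [1 / d] of the exponents.
    Comparing the size of the product of the [a^d - 1], [d <= D], with the
    valuations given by lifting the exponent shows that, whichever [s] primes
    are excluded, some other prime divides [a^d - 1] with [d <= 16 (s + 1)].
    Choosing classes greedily, the number [H] of unserved exponents and the
    number [s] of primes in use therefore satisfy: [H^16 (s + 1)] does not
    increase. For each of the boundedly many forms [n j +- a^h k] and each of
    [m ~ log log log x] rounds, let [s] grow by the factor [V^16], with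
    [V ~ (log log x)^2]. This leaves [O(log x / V)] exponents per round, each
    of which receives a small prime of its own, of size polynomial in [log x].
    The product [W] of all these primes is [x^(o(1))], so a residue class
    modulo [W] contains at least [x^(1 - eps)] integers of the interval, and
    all of them have the required property. *)

Require Import Defs.
From Stdlib Require Import Reals ZArith Znumtheory List FinFun Lra Lia.
From mathcomp Require all_boot zify.

(* [M] is the number of rounds and [r] the number of exponents left over by
   all of them; [Y] bounds the number of primes used in the rounds. *)
Definition modulus_bound (K V M r : nat) : nat :=
  (let Y := (K + 3) * V ^ (16 * M) in
   8 * (K + 2) ^ 2 * (K ^ (16 * Y * Y) * (8 * (Y + r) ^ 2) ^ r))%nat.

Module CoveringCongruences.

Import all_boot zify.
Set Implicit Arguments.
Unset Strict Implicit.
Unset Printing Implicit Defensive.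
Local Open Scope nat_scope.

(** * Prime divisors of [a^d - 1] *)

Lemma geometric_sum_mod (x q f : nat) : x = 1 %[mod q] ->
  \sum_(i < f) x ^ i = f %[mod q].
Proof.
move=> x1; elim: f => [|f IH]; first by rewrite big_ord0.
by rewrite big_ord_recr /= -modnDm IH -modnXm x1 modnXm exp1n modnDm addn1.
Qed.

(** Modulo [q ^ 2] the expansion of [(1 + q * u) ^ i] stops at [1 + i * (q * u)], and the numbers
    [i < f] add up to ['C(f, 2)]. *)
Lemma geometric_sum_mod_sqr (u q f : nat) :
  \sum_(i < f) (1 + q * u) ^ i = f + q * u * 'C(f, 2) %[mod q ^ 2].
Proof.
have pow i : (1 + q * u) ^ i = 1 + i * (q * u) %[mod q ^ 2].
  elim: i => [|i IH]; first by rewrite expn0.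
  rewrite expnS -modnMmr IH modnMmr.
  have -> : (1 + q * u) * (1 + i * (q * u)) = (i * u * u) * q ^ 2 + (1 + i.+1 * (q * u)).
    by rewrite -mulnn; nia.
  by rewrite modnMDl.
elim: f => [|f IH]; first by rewrite big_ord0 muln0.
rewrite big_ord_recr /= -modnDm IH pow modnDm binS bin1; congr (_ %% _); nia.
Qed.

Lemma logn_eq1 (q N : nat) : prime q -> N = q %[mod q ^ 2] -> logn q N = 1.
Proof.
move=> pq Nq; have q1 := prime_gt1 pq.
have qN : q %| N.
  have : q %| N %% q ^ 2 by rewrite Nq /dvdn modn_dvdm ?modnn // dvdn_exp.
  by rewrite /dvdn modn_dvdm // dvdn_exp.
have N0 : 0 < N.
  rewrite lt0n; apply/eqP => N0; move: Nq; rewrite N0 mod0n modn_small; last by rewrite -mulnn; nia.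
  lia.
apply/eqP; rewrite eqn_leq -{2}[1]/1; apply/andP; split; last by rewrite -pfactor_dvdn.
rewrite leqNgt -pfactor_dvdn //; apply/negP; rewrite /dvdn Nq modn_small; first by lia.
by rewrite -mulnn; nia.
Qed.

(** With [x = 1 + q * u] the sum is [q + q * u * 'C(q, 2)] modulo [q ^ 2]. For odd [q] the binomial
    coefficient is a multiple of [q]; for [q = 2] it is 1, and [4 %| x.-1] makes [u] even
    instead. *)
Lemma logn_geometric_sum_prime (q x : nat) : prime q -> 0 < x -> q %| x.-1 ->
  (q = 2 -> 4 %| x.-1) -> logn q (\sum_(i < q) x ^ i) = 1.
Proof.
move=> pq x0 /dvdnP[u xu] q2; apply: logn_eq1 => //.
have -> : x = 1 + q * u by lia.
rewrite geometric_sum_mod_sqr.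
suff /dvdnP[w ->] : q ^ 2 %| q * u * 'C(q, 2) by rewrite addnC modnMDl.
have [e2|qn2] := eqVneq q 2.
  by move: (q2 e2); rewrite xu e2 bin2 /= muln1 mulnC.
by rewrite -mulnn -mulnA dvdn_mul // dvdn_mull // prime_dvd_bin //; have := prime_gt1 pq; lia.
Qed.

(** Lifting the exponent, by induction on [f]. If [q] does not divide [f], the cofactor of [x - 1]
    in [x ^ f - 1] is [f] modulo [q], hence prime to [q]. If [f = g * q], passing from [x] to
    [x ^ q] gains exactly one factor [q]. *)
Lemma logn_pred_exp (q x f : nat) : prime q -> 1 < x -> q %| x.-1 ->
  (q = 2 -> 4 %| x.-1) -> 0 < f ->
  logn q (x ^ f).-1 = logn q x.-1 + logn q f.
Proof.
move=> pq; elim/ltn_ind: f x => f IH x x1 qx q2 f0.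
have x0 : 0 < x by lia.
have q1 := prime_gt1 pq.
have xq : x = 1 %[mod q].
  by apply/eqP; rewrite eqn_mod_dvd // subn1.
have sum0 g : 0 < g -> 0 < \sum_(i < g) x ^ i.
  by case: g => // g _; rewrite big_ord_recl expn0.
have [/dvdnP[g fg]|qf] := boolP (q %| f); last first.
  rewrite predn_exp lognM ?sum0 //; last by lia.
  have logn0 m : ~~ (q %| m) -> logn q m = 0 by move=> qm; rewrite lognE (negPf qm) !andbF.
  by rewrite (logn0 f) // (logn0 (\sum_(i < f) _)) // /dvdn (geometric_sum_mod f xq).
have g0 : 0 < g by case: g fg f0 => // ->.
have xq1 : 1 < x ^ q by rewrite -{1}(exp1n q) ltn_exp2r // ltnW.
have dvd : x.-1 %| (x ^ q).-1 by rewrite predn_exp dvdn_mulr.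
have gf : g < f by rewrite fg -{1}[g]muln1 ltn_pmul2l.
rewrite fg mulnC expnM IH //; [|exact: dvdn_trans dvd|by move=> /q2 h; exact: dvdn_trans dvd].
have xm0 : 0 < x.-1 by case: (x) x1 => [|[]].
rewrite predn_exp !lognM // ?sum0 ?prime_gt0 //.
by rewrite logn_geometric_sum_prime // (logn_prime q pq) eqxx addnA.
Qed.

Lemma prod_primes_sub (S : seq nat) n : 0 < n -> uniq S ->
  {subset primes n <= S} -> \prod_(q <- S) q ^ logn q n = n.
Proof.
move=> n0 uS sub; rewrite {2}(prod_prime_decomp n0) prime_decompE big_map /=.
rewrite (bigID (mem (primes n))) /= [X in _ * X]big1 ?muln1.
  rewrite -big_filter; apply: perm_big; apply: uniq_perm; rewrite ?filter_uniq ?primes_uniq //.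
  by move=> p; rewrite mem_filter /=; case: (boolP (p \in primes n)) => //= /sub.
by move=> p pn; rewrite lognE; move: pn; rewrite mem_primes; case: ifP.
Qed.

Lemma prod_logn_le (S : seq nat) n : 0 < n -> uniq S ->
  \prod_(q <- S) q ^ logn q n <= n.
Proof.
move=> n0 uS; set T := undup (S ++ primes n).
have uT : uniq T by rewrite undup_uniq.
rewrite -{2}(@prod_primes_sub T n) //; last first.
  by move=> p pn; rewrite mem_undup mem_cat pn orbT.
have pS : perm_eq S [seq q <- T | q \in S].
  apply: uniq_perm => //; first by rewrite filter_uniq.
  by move=> p; rewrite mem_filter /T mem_undup mem_cat; case: (p \in S).
rewrite [leqLHS](perm_big _ pS) big_filter /= [leqRHS](bigID (mem S)) /=.
by rewrite leq_pmulr // prodn_gt0.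
Qed.

(* With [e] the order of [b] modulo [q], lifting the exponent gives
   [v_q (b^d - 1) <= v_q (b^e - 1) + v_q d] for the [D / e] multiples [d] of
   [e], and the valuation vanishes for the other [d]. *)
Lemma prod_pfactor_le b q D : 1 < b -> (q = 2 -> odd b -> 4 %| b.-1) ->
  \prod_(1 <= d < D.+1) q ^ logn q (b ^ d).-1 <=
  b ^ D * \prod_(1 <= d < D.+1) q ^ logn q d.
Proof.
move=> b1 b2.
have b0 : 0 < b by exact: ltnW.
have [pq|npq] := boolP (prime q); last first.
  have l0 n : logn q n = 0 by rewrite lognE (negPf npq).
  rewrite !big1 ?muln1 ?expn_gt0 ?b0 // => i _; by rewrite l0.
have q0 := prime_gt0 pq.
have prod0 : 0 < \prod_(1 <= d < D.+1) q ^ logn q d.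
  by rewrite prodn_gt0 // => d; rewrite expn_gt0 q0.
have [/hasP[d0]|/hasPn none] := boolP (has (fun d => q %| (b ^ d).-1) (index_iota 1 D.+1)); last first.
  rewrite big_seq big1 => [|d dD]; first by rewrite muln_gt0 expn_gt0 b0.
  by rewrite lognE (negPf (none _ dD)) !andbF.
rewrite mem_index_iota => /andP[d01 d0D] qd0.
have ex : exists e, (0 < e) && (q %| (b ^ e).-1) by exists d0; rewrite d01.
case: (ex_minnP ex) => e /andP[e0 qe] emin.
have eD : e <= D by apply: leq_trans (emin d0 _) _; rewrite ?d01.
have bpow1 d : (q %| (b ^ d).-1) = (b ^ d == 1 %[mod q]).
  by rewrite eqn_mod_dvd ?expn_gt0 ?b0 // subn1.
have be1 : b ^ e = 1 %[mod q] by apply/eqP; rewrite -bpow1.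
have order d : q %| (b ^ d).-1 -> e %| d.
  rewrite bpow1 {1}(divn_eq d e) expnD (mulnC (d %/ e)) expnM -modnMml -modnXm be1.
  rewrite modnXm exp1n modnMml mul1n -bpow1 => qr; rewrite /dvdn.
  case: posnP => // r0; have := emin (d %% e); rewrite r0 qr => /(_ isT).
  by rewrite leqNgt ltn_mod e0.
set v := logn q (b ^ e).-1.
have b1e : 1 < b ^ e by rewrite -{1}(exp1n e) ltn_exp2r.
have lte d : 0 < d -> e %| d -> logn q (b ^ d).-1 <= v + logn q d.
  move=> d0' /dvdnP[f df]; have f0 : 0 < f by case: f df d0' => // ->.
  rewrite df mulnC expnM logn_pred_exp //; last first.
    move=> q2; apply: (@dvdn_trans b.-1); last by rewrite predn_exp dvdn_mulr.
    apply: b2 => //; apply/negPn/negP => evb; move: qe; rewrite q2 dvdn2.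
    by rewrite -subn1 oddB ?expn_gt0 ?b0 // oddX (negPf evb) orbF eqn0Ngt e0.
  by rewrite leq_add2l lognM // leq_addl.
apply: (@leq_trans (\prod_(1 <= d < D.+1) (q ^ (v * (e %| d)) * q ^ logn q d))).
  rewrite big_seq [leqRHS]big_seq; apply: leq_prod => d; rewrite mem_index_iota => /andP[d0' _].
  rewrite -expnD leq_exp2l ?prime_gt1 //.
  have [ed|ned] := boolP (e %| d); first by rewrite muln1 lte.
  rewrite lognE; case: ifP => // /and3P[_ _ /order]; by rewrite (negPf ned).
rewrite big_split /= leq_pmul2r // -expn_sum -big_distrr /= -divn_count_dvd.
(* As [q ^ v] divides [b ^ e - 1], it is below [b ^ e]. *)
rewrite expnM; apply: (@leq_trans ((b ^ e) ^ (D %/ e))).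
  rewrite leq_exp2r ?divn_gt0 //; apply: leq_trans (leq_pred _).
  by apply: dvdn_leq; [case: (b ^ e) b1e => [|[]] | exact: pfactor_dvdnn].
by rewrite -expnM leq_exp2l // mulnC leq_trunc_div.
Qed.

(** The base is squared so that lifting the exponent also works at 2; this doubles the period,
    whence [16 = 2 * 8]. If only primes of [S] occurred, the product of the [b ^ d - 1], [d <= D],
    would be at least [b ^ 'C(D, 2)] and at most [b ^ (D * s)] times the factorial of [D]. That
    factorial is at most [D ^ D <= b ^ (s.+2 * D)], which is too small for [D = 8 * s.+1]. *)
Lemma exists_new_prime_divisor a (S : seq nat) : 1 < a ->
  exists d q, [/\ 0 < d <= 16 * (size S).+1, prime q, q \notin S & q %| (a ^ d).-1].
Proof.
move=> a1; set b := a ^ 2; set U := undup S; set s := size S; set D := 8 * s.+1.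
have b1 : 1 < b by rewrite -(exp1n 2) ltn_exp2r.
have b2 : odd b -> 4 %| b.-1.
  rewrite oddX /= => oa; have := odd_double_half a; rewrite oa /b.
  move: (a./2) => h <-; apply/dvdnP; exists (h * h + h).
  by rewrite -mulnn -muln2; lia.
case: (boolP (all (fun d => all (mem U) (primes (b ^ d).-1)) (index_iota 1 D.+1))); last first.
  case/allPn=> d; rewrite mem_index_iota => /andP[d0 dD] /allPn[q].
  rewrite mem_primes => /and3P[pq _ qd]; rewrite /= /U mem_undup => qS.
  exists (2 * d), q; split=> //; last by rewrite expnM.
  by rewrite muln_gt0 d0 /=; rewrite /D in dD; lia.
move=> /allP all_in; exfalso.
have p0 d : 0 < d -> 0 < (b ^ d).-1.
  by move=> d0; rewrite -subn1 subn_gt0 -(exp1n d) ltn_exp2r.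
have E : \prod_(1 <= d < D.+1) (b ^ d).-1 =
         \prod_(q <- U) \prod_(1 <= d < D.+1) q ^ logn q (b ^ d).-1.
  rewrite exchange_big big_seq [RHS]big_seq; apply: eq_bigr => d dD.
  rewrite prod_primes_sub ?undup_uniq //; first by apply: p0; move: dD; rewrite mem_index_iota; lia.
  by move=> p; apply: (allP (all_in d dD)).
have lower n : b ^ 'C(n, 2) <= \prod_(1 <= d < n.+1) (b ^ d).-1.
  elim: n => [|n IH]; first by rewrite big_geq.
  rewrite big_nat_recr //= binS bin1 addnC expnD mulnC leq_mul //.
  rewrite expnS; have : 0 < b ^ n by rewrite expn_gt0 ltnW.
  by move: b1; nia.
have upper : \prod_(1 <= d < D.+1) (b ^ d).-1 <= b ^ (D * s) * D`!.
  rewrite E; apply: (@leq_trans (\prod_(q <- U) (b ^ D * \prod_(1 <= d < D.+1) q ^ logn q d))).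
    by apply: leq_prod => q _; apply: prod_pfactor_le.
  rewrite big_split /= big_const_seq count_predT iter_muln_1 -expnM; apply: leq_mul.
    by rewrite leq_exp2l // leq_mul2l size_undup orbT.
  rewrite exchange_big fact_prod /= big_seq [leqRHS]big_seq; apply: leq_prod => d.
  rewrite mem_index_iota => /andP[d0 _]; apply: prod_logn_le => //; exact: undup_uniq.
have factD n : n`! <= n ^ n.
  elim: n => // n IH; rewrite factS expnS leq_mul2l /=; apply: leq_trans IH _.
  by case: n => // n; rewrite leq_exp2r.
have Db : D <= b ^ s.+2.
  apply: (@leq_trans (4 ^ s.+2)); last by rewrite leq_exp2r // /b -mulnn (leq_mul a1 a1).
  by rewrite /D; elim: (s) => // n; rewrite (expnS 4 n.+2); lia.
have : b ^ 'C(D, 2) <= b ^ (D * s + s.+2 * D).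
  apply: leq_trans (lower D) _; apply: leq_trans upper _; rewrite expnD leq_mul2l.
  apply/orP; right; apply: leq_trans (factD D) _; rewrite expnM leq_exp2r //.
rewrite leq_exp2l // => le.
have E2 : D * D.-1 = 2 * 'C(D, 2).
  by have := mul_bin_diag D 1; rewrite bin1.
move: le; rewrite -(leq_pmul2l (isT : 0 < 2)) -E2 /D; nia.
Qed.

(** * Small primes *)

Lemma central_binomial_ge n : 2 ^ n <= 'C(2 * n, n).
Proof.
elim: n => // n IH.
have H : n.+1 * 'C(2 * n.+1, n.+1) = 2 * ((2 * n).+1 * 'C(2 * n, n)).
  have -> : 2 * n.+1 = (2 * n).+2 by lia.
  have h1 := mul_bin_diag (2 * n).+2 n.
  have h2 := mul_bin_diag (2 * n).+1 n.
  have h3 : 'C((2 * n).+1, n.+1) = 'C((2 * n).+1, n).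
    rewrite -bin_sub; last by lia.
    by congr 'C(_, _); lia.
  rewrite -h1 /= -h3 h2; lia.
rewrite -(leq_pmul2l (ltn0Sn n)) H expnS; nia.
Qed.

(** By Legendre's formula the valuation is a sum over [k] of [(2 * n) %/ p ^ k - 2 * (n %/ p ^ k)].
    Each term is at most 1 and vanishes once [p ^ k > 2 * n]. *)
Lemma pfactor_central_binomial_le p n : 0 < n -> p ^ logn p 'C(2 * n, n) <= 2 * n.
Proof.
move=> n0; have [pp|npp] := boolP (prime p); last by rewrite lognE (negPf npp) /= expn0; lia.
have p1 := prime_gt1 pp.
have n2 : 0 < 2 * n by lia.
apply: leq_trans (trunc_logP p1 n2); rewrite leq_exp2l //.
have le_n : n <= 2 * n by lia.
have := congr1 (logn p) (bin_fact le_n).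
have -> : 2 * n - n = n by lia.
rewrite !lognM ?muln_gt0 ?fact_gt0 ?bin_gt0 // !logn_fact //.
have wide : \sum_(1 <= k < n.+1) n %/ p ^ k = \sum_(1 <= k < (2 * n).+1) n %/ p ^ k.
  rewrite [RHS](big_cat_nat (n := n.+1)) //= ?ltnS // [X in _ + X]big1_seq ?addn0 // => k.
  rewrite mem_index_iota => /and3P[_ nk _]; rewrite divn_small //.
  by apply: leq_trans nk _; apply: ltnW; apply: ltn_expl.
rewrite wide => E; set t := trunc_log p (2 * n).
have : \sum_(1 <= k < (2 * n).+1) (2 * n) %/ p ^ k <=
  \sum_(1 <= k < (2 * n).+1) (n %/ p ^ k + n %/ p ^ k) + \sum_(1 <= k < (2 * n).+1) (k <= t).
  rewrite -big_split /=; apply: leq_sum => k _.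
  have pk0 : 0 < p ^ k by rewrite expn_gt0 ltnW.
  case: (leqP k t) => [_|tk] /=.
    rewrite {1}(divn_eq n (p ^ k)).
    have := ltn_pmod n pk0; set r := n %% _; set w := n %/ _; set P := p ^ k in pk0 * => rP.
    have : 2 * (w * P + r) < (w + w + 1).+1 * P by nia.
    by rewrite -ltn_divLR.
  by rewrite divn_small //; apply: leq_trans (trunc_log_ltn (2 * n) p1) _; rewrite leq_exp2l.
rewrite big_split /= -E => le.
have cnt : \sum_(1 <= k < (2 * n).+1) (k <= t) <= t.
  elim: (2 * n) => [|N IH]; first by rewrite big_geq.
  rewrite big_nat_recr //=; case: (leqP N.+1 t) => Nt /=; last by rewrite addn0.
  rewrite (eq_big_nat _ _ (F2 := fun _ => 1)); first by rewrite sum_nat_const_nat; lia.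
  by move=> i /andP[_ iN]; have -> : i <= t by lia.
by move: le cnt; lia.
Qed.

(** Otherwise ['C(2 * n, n)] with [n = 4 * s.+1 ^ 2] would be a product of at most [s] prime powers,
    each at most [2 * n <= 2 ^ (3 + s * 2)]. Being at least [2 ^ n], it would force
    [n <= (3 + s * 2) * s]. *)
Lemma exists_new_small_prime (S : seq nat) :
  exists q, [/\ prime q, q \notin S & q <= 8 * (size S).+1 ^ 2].
Proof.
set s := size S; set n := 4 * s.+1 ^ 2; set U := undup S.
have n0 : 0 < n by rewrite muln_gt0 expn_gt0.
have b0 : 0 < 'C(2 * n, n) by rewrite bin_gt0; lia.
case: (boolP (all (mem U) (primes 'C(2 * n, n)))); last first.
  case/allPn => q; rewrite mem_primes => /and3P[pq _ qd]; rewrite /= /U mem_undup => qS.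
  exists q; split=> //.
  have -> : 8 * s.+1 ^ 2 = 2 * n by rewrite /n; lia.
  apply: leq_trans (pfactor_central_binomial_le q n0); rewrite -{1}[q]expn1 leq_exp2l ?prime_gt1 //.
  by rewrite -pfactor_dvdn.
move=> /allP sub; exfalso.
have up : 'C(2 * n, n) <= (2 * n) ^ s.
  rewrite -(@prod_primes_sub U _ b0) ?undup_uniq //.
  apply: (@leq_trans (\prod_(q <- U) (2 * n))).
    by apply: leq_prod => q _; apply: pfactor_central_binomial_le.
  by rewrite big_const_seq count_predT iter_muln_1 leq_exp2l ?size_undup //; lia.
have s2 : s.+1 <= 2 ^ s by apply: ltn_expl.
have n2 : 2 * n <= 2 ^ (3 + s * 2).
  by rewrite expnD expnM /n mulnA leq_mul2l /= leq_exp2r.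
have : 2 ^ n <= 2 ^ ((3 + s * 2) * s).
  apply: leq_trans (central_binomial_ge n) _; apply: leq_trans up _.
  rewrite expnM; case: (s) n2 => // m n2; by rewrite leq_exp2r.
by rewrite leq_exp2l // /n -mulnn; nia.
Qed.

(** * Greedy coverings *)

Lemma pigeonhole_residue (H : seq nat) d : 0 < d ->
  exists b, size H <= d * count (fun h => h == b %[mod d]) H.
Proof.
move=> d0.
have sumE : size H = \sum_(b < d) count (fun h => h == b %[mod d]) H.
  elim: H => [|h H IH] /=; first by rewrite big1.
  rewrite big_split /= -IH (bigD1 (Ordinal (ltn_pmod h d0))) //= modn_mod eqxx big1 ?addn0 ?add1n //.
  move=> i; rewrite -val_eqE /= (modn_small (ltn_ord i)) eq_sym => /negPf -> //.
case: (boolP [exists b : 'I_d, size H <= d * count (fun h => h == b %[mod d]) H]).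
  by move=> /existsP[b ?]; exists b.
rewrite negb_exists => /forallP none.
exists 0; have [->//|Hn0] := eqVneq (size H) 0.
have : d * size H < d * size H; last by rewrite ltnn.
rewrite {1}sumE big_distrr /=; apply: (@leq_trans (\sum_(b < d) (size H).-1).+1).
  rewrite ltnS; apply: leq_sum => i _; have := none i; rewrite -ltnNge; lia.
by rewrite sum_nat_const card_ord; nia.
Qed.

(* The potential [h^16 * y] does not increase: with [w = 16 y - 1],
   [(w + 1)^16 >= w^16 + 16 w^15]. *)
Lemma potential_step h h' d y : 0 < d <= 16 * y -> d * h' <= d.-1 * h ->
  h' ^ 16 * y.+1 <= h ^ 16 * y.
Proof.
move=> /andP[d0 dy] dh; set w := (16 * y).-1.
have y0 : 0 < y by lia.
(* The remaining proportion [(d - 1) / d] is largest at [d = 16 * y], where it equals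
   [w / (w + 1)]. *)
have wh : w.+1 * h' <= w * h.
  have h'h : h' <= h by rewrite -(leq_pmul2l d0); apply: leq_trans dh _; rewrite leq_mul2r leq_pred orbT.
  have -> : w = (16 * y - d) + d.-1 by rewrite /w; lia.
  by rewrite -addnS mulnDl [leqRHS]mulnDl leq_add // ?leq_mul2l ?h'h ?orbT // prednK.
have bern n : w ^ n * w + n * w ^ n <= (w.+1) ^ n * w.
  elim: n => [|n IH]; first by rewrite mul1n mul0n addn0.
  have := leq_mul (leqnn w.+1) IH; rewrite !expnS.
  by move: (w ^ n) (w.+1 ^ n) (w) => A B z; lia.
have w0 : 0 < w by rewrite /w; lia.
have step : w ^ 16 * y.+1 <= w.+1 ^ 16 * y.
  rewrite -(leq_pmul2r w0); have := bern 16; set A := w ^ 16; set B := w.+1 ^ 16.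
  move=> bn; move: (leq_mul bn (leqnn y)).
  have : A * w <= A * (16 * y) by rewrite leq_mul2l leq_pred orbT.
  move: (w) => z; lia.
have le16 : w.+1 ^ 16 * h' ^ 16 <= w ^ 16 * h ^ 16 by rewrite -!expnMn leq_exp2r.
have wn0 : 0 < w.+1 ^ 16 by rewrite expn_gt0.
rewrite -(leq_pmul2l wn0) mulnA; apply: leq_trans (leq_mul le16 (leqnn y.+1)) _.
by rewrite mulnAC [leqRHS]mulnCA [leqRHS]mulnC leq_mul2r step orbT.
Qed.

Section Covering.
Variables (T : eqType) (base : T -> nat) (K L : nat).

(* [Congruence q t b d] stands for the requirement that the prime [q] divide
   the form of type [t] with exponent [b]; as [q] divides [base t ^ d - 1], it
   then divides the form with every exponent [h = b %[mod d]]. The value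
   [d = 0] encodes a prime used for the single exponent [b]. *)
Record congruence := Congruence
  { modulus : nat; target : T; exponent : nat; period : nat }.

(** As [m %% 0 = m], a congruence of period 0 covers its own exponent only. *)
Definition covers (t : T) (h : nat) (c : congruence) : bool :=
  (target c == t) && (h == exponent c %[mod period c]).

(** [P] lists the numbers excluded as moduli, such as primes already in use. The last condition
    admits period 0, since a power with exponent 0 is 1. *)
Definition valid (P : seq nat) (B : nat) (G : seq congruence) : Prop :=
  [/\ uniq (map modulus G), {in map modulus G, forall q, (q \notin P) && (q <= B)} &
  forall c, List.In c G ->
    prime (modulus c) /\ base (target c) ^ period c = 1 %[mod modulus c]].

Lemma valid_cat P B B' G G' : B <= B' -> valid P B G -> valid (map modulus G ++ P) B' G' ->
  valid P B' (G' ++ G).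
Proof.
move=> BB' [uG GP Gc] [uG' GP' Gc']; split.
- rewrite map_cat cat_uniq uG uG' andbT /=; apply/hasPn => q qG.
  by apply/negP => /GP'; rewrite mem_cat qG.
- move=> q; rewrite map_cat mem_cat => /orP[/GP'|/GP].
    by rewrite mem_cat negb_or -andbA => /and3P[_ -> ->].
  by move=> /andP[-> qB]; rewrite (leq_trans qB).
- by move=> c cG; case: (List.in_app_or _ _ _ cG) => [/Gc'|/Gc].
Qed.

Lemma valid_cons P B c G : modulus c \notin P -> modulus c <= B -> prime (modulus c) ->
  base (target c) ^ period c = 1 %[mod modulus c] ->
  valid (modulus c :: P) B G -> valid P B (rcons G c).
Proof.
move=> cP cB pc bc vG; rewrite -cats1; apply: (@valid_cat _ B) => //.
split=> //= [q|c' [<-|[]] //]; by rewrite inE => /eqP ->; rewrite cP.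
Qed.

(** Each step takes a new prime of period [d] and the class modulo [d] richest in [H]. At most
    [d - 1] out of [d] exponents remain, so [potential_step] applies with [y = (size P).+1]. The
    prime divides [base t ^ d - 1], which bounds it. *)
Lemma greedy_covering t n : 1 < base t -> forall (P : seq nat) (H : seq nat),
  exists G, [/\ valid P (base t ^ (16 * (size P + n))) G, size G = n &
    size [seq h <- H | ~~ has (covers t h) G] ^ 16 * (size P + n).+1 <=
    size H ^ 16 * (size P).+1].
Proof.
move=> b1; elim: n => [|n IH] P H.
  exists [::]; split=> //.
  by rewrite /= filter_predT addn0.
have [d [q [/andP[d0 dP] pq qP qd]]] := exists_new_prime_divisor P b1.
have [b bH] := pigeonhole_residue H d0.
set c := Congruence q t b d.
have [G [vG sG lG]] := IH (q :: P) [seq h <- H | ~~ covers t h c].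
have bd0 m : 0 < base t ^ m by rewrite expn_gt0 ltnW.
exists (rcons G c); split.
- apply: valid_cons => //=.
  + apply: (@leq_trans (base t ^ d)); last by rewrite leq_exp2l //; lia.
    apply: leq_trans (leq_pred _); apply: dvdn_leq => //.
    by rewrite -subn1 subn_gt0 -(exp1n d) ltn_exp2r.
  + by apply/eqP; rewrite eqn_mod_dvd // subn1.
  + by move: vG; rewrite /= addSnnS.
- by rewrite size_rcons sG.
rewrite (_ : [seq h <- H | _] = [seq h <- [seq h <- H | ~~ covers t h c] | ~~ has (covers t h) G]); last first.
  rewrite -filter_predI; apply: eq_filter => h /=.
  by rewrite has_rcons negb_or andbC.
rewrite -addSnnS; apply: leq_trans lG _.
apply: (@potential_step _ _ d); first by rewrite d0.
have cov : count (covers t ^~ c) H = count (fun h => h == b %[mod d]) H.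
  by apply: eq_count => h; rewrite /covers /= eqxx.
rewrite size_filter; move: bH; rewrite -(count_predC (covers t ^~ c) H) cov.
rewrite -[d.-1]subn1 mulnBl mul1n mulnDr; move: (count _ H) (count _ H) => u v; lia.
Qed.

(* One greedy round per element of [us]: each round multiplies the number of
   primes in use by [V^16] and leaves a proportion [1 / V] uncovered. *)
Lemma greedy_rounds V us : 0 < V -> (forall t, t \in us -> 1 < base t <= K) ->
  forall P, exists G (R : seq (T * nat)),
  let Y := (size P).+1 * V ^ (16 * size us) in
  [/\ valid P (K ^ (16 * Y)) G, size G + (size P).+1 <= Y, size R * V <= size us * L.+1 &
    forall t h, h <= L -> count_mem t us <= count (covers t h) G + count_mem (t, h) R].
Proof.
move=> V0; elim: us => [|u us IH] usK P.
  by exists [::], [::]; split=> //=; rewrite muln0 expn0 muln1.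
have /andP[u1 uK] : 1 < base u <= K by apply: usK; rewrite mem_head.
(* This number of primes makes the count [(size P).+1] grow by the factor [V ^ 16]. *)
set n := (size P).+1 * (V ^ 16).-1.
have V16 : 0 < V ^ 16 by rewrite expn_gt0 V0.
have Pn : (size P + n).+1 = (size P).+1 * V ^ 16.
  by rewrite -addSn /n -{1}[(size P).+1]muln1 -mulnDr add1n prednK.
have [G1 [vG1 sG1 lG1]] := greedy_covering n u1 P (iota 0 L.+1).
have [|G2 [R [vG2 sG2 sR cG2]]] := IH _ (map modulus G1 ++ P).
  by move=> t tus; apply: usK; rewrite inE tus orbT.
set left := [seq h <- iota 0 L.+1 | ~~ has (covers u h) G1] in lG1.
exists (G2 ++ G1), ([seq (u, h) | h <- left] ++ R) => Y.
have YE : (size (map modulus G1 ++ P)).+1 * V ^ (16 * size us) = Y.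
  by rewrite size_cat size_map sG1 addnC Pn /Y /= mulnS expnD mulnA.
have nY : (size P + n).+1 <= Y.
  by rewrite -YE size_cat size_map sG1 addnC leq_pmulr // expn_gt0 V0.
rewrite YE in vG2 sG2; split.
- apply: valid_cat vG1 vG2; apply: (@leq_trans (K ^ (16 * (size P + n)))).
    have [->|N0] := posnP (size P + n); first by rewrite muln0.
    by rewrite leq_exp2r // muln_gt0.
  by rewrite leq_exp2l ?leq_mul2l ?(ltnW nY) //; apply: leq_trans uK.
- by move: sG2; rewrite !size_cat size_map; lia.
- rewrite size_cat size_map /= mulnDl mulSn; apply: leq_add sR.
  (* That [left] has at most [(L + 1) / V] elements is the potential inequality after extraction of
     16th roots. *)
  rewrite -(@leq_exp2r _ _ 16) // expnMn -(@leq_pmul2r (size P).+1) //.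
  by move: lG1; rewrite Pn size_iota -mulnA [V ^ 16 * _]mulnC.
move=> t h hL; have := cG2 t h hL.
suff : (u == t) <= count (covers t h) G1 + count_mem (t, h) [seq (u, h0) | h0 <- left].
  by rewrite !count_cat /=; lia.
have [hc|nc] := boolP (has (covers u h) G1).
  by case: eqP => // <-; apply: leq_trans (leq_addr _ _); rewrite -has_count.
case: eqP => // <-; apply: leq_trans (leq_addl _ _); rewrite -has_count has_pred1.
by apply: map_f; rewrite mem_filter nc mem_iota /= ltnS.
Qed.

(** Every occurrence in [R] gets its own prime of period 0. Each choice avoids fewer than
    [size P + size R] numbers, whence the bound. *)
Lemma single_coverings (R : seq (T * nat)) : forall P, exists G,
  [/\ valid P (8 * (size P + size R) ^ 2) G, size G = size R &
    forall t h, count_mem (t, h) R <= count (covers t h) G].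
Proof.
elim: R => [|[t0 h0] R IH] P; first by exists [::]; split.
have [q [pq qP qB]] := exists_new_small_prime P.
have [G [vG sG cG]] := IH (q :: P).
exists (rcons G (Congruence q t0 h0 0)); split.
- apply: valid_cons => //=; last by move: vG; rewrite /= addSnnS.
  by apply: leq_trans qB _; rewrite leq_mul2l leq_exp2r // -addSnnS leq_addr.
- by rewrite size_rcons sG.
move=> t h; rewrite -cats1 count_cat addnC /= addn0; apply: leq_add => //.
by rewrite /covers xpair_eqE /= [h == h0]eq_sym; case: (t0 == t) => //=; case: eqP => // ->; rewrite eqxx.
Qed.

Lemma valid_prod_le P B G : valid P B G -> \prod_(c <- G) modulus c <= B ^ size G.
Proof.
case=> _ GB _; rewrite -(size_map modulus) -(big_map modulus predT id) big_seq.
rewrite -[size _]count_predT -iter_muln_1 -big_const_seq [leqRHS]big_seq.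
by apply: leq_prod => q /GB /andP[].
Qed.

(** The greedy rounds contribute at most [Y] primes below [K ^ (16 * Y)], and the [r] exponents left
    over contribute one prime each, at most [8 * (Y + r) ^ 2]. *)
Lemma covering_system V us P : 0 < K -> 0 < V -> (forall t, t \in us -> 1 < base t <= K) ->
  let Y := (size P).+1 * V ^ (16 * size us) in
  exists G r, [/\ exists B, valid P B G,
    forall t h, h <= L -> count_mem t us <= count (covers t h) G,
    r * V <= size us * L.+1 &
    \prod_(c <- G) modulus c <= K ^ (16 * Y * Y) * (8 * (Y + r) ^ 2) ^ r].
Proof.
move=> K0 V0 usK Y.
have [G1 [R [vG1 sG1 sR cG1]]] := greedy_rounds V0 usK P.
have [G2 [vG2 sG2 cG2]] := single_coverings R (map modulus G1 ++ P).
rewrite -/Y in vG1 sG1.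
have Y1 : 0 < Y by apply: leq_trans sG1; rewrite addnS.
exists (G2 ++ G1), (size R); split=> //.
- exists (K ^ (16 * Y) + 8 * (size (map modulus G1 ++ P) + size R) ^ 2).
  apply: valid_cat vG1 _; first exact: leq_addr.
  case: vG2 => u le c; split=> // q /le /andP[-> /= h]; apply: leq_trans h (leq_addl _ _).
- move=> t h hL; apply: leq_trans (cG1 t h hL) _.
  by rewrite count_cat addnC leq_add2r cG2.
rewrite big_cat /= mulnC; apply: leq_mul.
  apply: leq_trans (valid_prod_le vG1) _; rewrite -expnM.
  by rewrite leq_pexp2l // leq_mul2l; move: sG1; lia.
apply: leq_trans (valid_prod_le vG2) _; rewrite sG2; case: (size R) => // r.
rewrite leq_exp2r // leq_mul2l leq_exp2r // leq_add2r size_cat size_map; move: sG1; lia.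
Qed.

End Covering.

Arguments modulus {T} c.

(** * Residue classes *)

Lemma powE a n : Nat.pow a n = a ^ n.
Proof. by elim: n => //= n ->; rewrite expnS. Qed.

Lemma Z_of_nat_expn a n : Z.of_nat (a ^ n) = (Z.of_nat a ^ Z.of_nat n)%Z.
Proof. by rewrite -powE Nat2Z.inj_pow. Qed.

Lemma Z_divide_nat p m : 0 < p -> (Z.of_nat p | Z.of_nat m)%Z -> p %| m.
Proof. by move=> p0 [c E]; apply/dvdnP; exists (Z.to_nat c); nia. Qed.

Lemma Z_prime q : prime q -> Znumtheory.prime (Z.of_nat q).
Proof.
move=> pq; apply/prime_alt; split; first by have := prime_gt1 pq; lia.
move=> n [n1 nq] nd; case/primeP: pq => q1 /(_ (Z.to_nat n)).
have -> : Z.to_nat n %| q by apply: Z_divide_nat; [lia | rewrite Z2Nat.id //; lia].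
by move=> /(_ isT) /orP[] /eqP; lia.
Qed.

Lemma omega_ge (m : Z) (l : list Z) : m <> 0%Z -> NoDup l ->
  (forall p, In p l -> Znumtheory.prime p /\ (p | m)%Z) -> (length l <= omega m)%coq_nat.
Proof.
move=> m0 ul lp; apply: NoDup_incl_length => // p pl.
have [pp pm] := lp p pl; have p2 := prime_ge_2 p pp.
have pm' : (p <= Z.abs m)%Z by apply: Z.divide_pos_le; [lia | apply/Z.divide_abs_r].
apply/filter_In; split.
  by apply/in_map_iff; exists (Z.to_nat p); split; [lia | apply/in_seq; lia].
case: (prime_dec p) => // _; apply/Z.eqb_eq/Z.rem_divide; [lia|exact: pm].
Qed.

Lemma Z_coprime_prod q (s : seq nat) : prime q -> all prime s -> q \notin s ->
  rel_prime (Z.of_nat q) (Z.of_nat (\prod_(p <- s) p)).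
Proof.
move=> pq ps qs; apply: prime_rel_prime; first exact: Z_prime.
move=> /(Z_divide_nat (prime_gt0 pq)); apply/negP; elim: s ps qs => [|p s IH] /=.
  by rewrite big_nil dvdn1; case: q pq => [|[|]].
move=> /andP[pp ps]; rewrite inE negb_or => /andP[qp qs].
by rewrite big_cons Euclid_dvdM // negb_or dvdn_prime2 // qp IH.
Qed.

(** Each prime carries a property of [n] implied by some residue, so that divisibility of a form can
    be prescribed without naming the residue. *)
Lemma chinese_remainder (l : seq (nat * (Z -> Prop))) :
  uniq (map fst l) -> all prime (map fst l) ->
  (forall c, In c l -> exists r, forall n, (Z.of_nat c.1 | n - r)%Z -> c.2 n) ->
  exists n0, forall n, (Z.of_nat (\prod_(q <- map fst l) q) | n - n0)%Z ->
    forall c, In c l -> c.2 n.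
Proof.
elim: l => [|c l IH] /=; first by exists 0%Z.
move=> /andP[cl ul] /andP[pc pl] sol.
have [|n1 H1] := IH ul pl; first by move=> c' cl'; apply: sol; right.
have [r Hr] := sol c (or_introl (erefl _)).
have /rel_prime_bezout[u v uv] := Z_coprime_prod pc pl cl.
rewrite big_cons; move: uv H1; move: (\prod_(q <- _) q) => W uv H1.
(* Since [u * q + v * W = 1] for the new prime [q], this number is [n1] modulo [W] and [r] modulo
   [q]. *)
exists (n1 + Z.of_nat W * v * (r - n1))%Z => n; rewrite Nat2Z.inj_mul => -[w nw] c' [<-|cl'].
  apply: Hr; exists (w * Z.of_nat W + (n1 - r) * u)%Z.
  have -> : n = (n1 + Z.of_nat W * v * (r - n1) + w * (Z.of_nat c.1 * Z.of_nat W))%Z by lia.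
  transitivity ((n1 - r) * (1 - v * Z.of_nat W) + w * (Z.of_nat c.1 * Z.of_nat W))%Z; first by ring.
  have -> : (1 - v * Z.of_nat W = u * Z.of_nat c.1)%Z by lia.
  by ring.
apply: H1 cl'; exists (v * (r - n1) + w * Z.of_nat c.1)%Z.
have -> : n = (n1 + Z.of_nat W * v * (r - n1) + w * (Z.of_nat c.1 * Z.of_nat W))%Z by lia.
by ring.
Qed.

(** The residue is [- e] times the inverse of [j]. The application has [j <= K], and numbers up to
    [K] are excluded as moduli. *)
Lemma linear_residue q j (e : Z) : prime q -> 0 < j < q ->
  exists r, forall n, (Z.of_nat q | n - r)%Z -> (Z.of_nat q | n * Z.of_nat j + e)%Z.
Proof.
move=> pq /andP[j0 jq].
have /rel_prime_bezout[u v uv] : rel_prime (Z.of_nat q) (Z.of_nat j).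
  apply: prime_rel_prime; first exact: Z_prime.
  by move=> /(Z_divide_nat (prime_gt0 pq)) /(dvdn_leq j0); lia.
exists (- e * v)%Z => n [w nw]; exists (w * Z.of_nat j + e * u)%Z.
have -> : n = (w * Z.of_nat q - e * v)%Z by lia.
transitivity (w * Z.of_nat q * Z.of_nat j - e * (v * Z.of_nat j) + e)%Z; first by ring.
have -> : (v * Z.of_nat j = 1 - u * Z.of_nat q)%Z by lia.
by ring.
Qed.

Lemma expn_eq_mod a d h b q : a ^ d = 1 %[mod q] -> h = b %[mod d] ->
  a ^ h = a ^ b %[mod q].
Proof.
move=> ad hb.
have red n : a ^ n = a ^ (n %% d) %[mod q].
  rewrite {1}(divn_eq n d) expnD (mulnC (n %/ d)) expnM -modnMml -modnXm ad.
  by rewrite modnXm exp1n modnMml mul1n.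
by rewrite red hb -red.
Qed.

Lemma Z_divide_eq_mod q x y : x = y %[mod q] -> (Z.of_nat q | Z.of_nat x - Z.of_nat y)%Z.
Proof.
move=> xy; exists (Z.of_nat (x %/ q) - Z.of_nat (y %/ q))%Z.
by have := divn_eq x q; have := divn_eq y q; rewrite xy; lia.
Qed.

Lemma uniq_NoDup (s : seq nat) : uniq s -> NoDup s.
Proof.
elim: s => [|x s IH] /=; first by constructor.
move=> /andP[xs us]; constructor; last exact: IH.
by move=> xs'; move/negP: xs; apply; elim: s xs' {IH us} => //= y s IH [->|/IH]; rewrite inE ?eqxx // => ->; rewrite orbT.
Qed.

Definition form (n : Z) (t : nat * nat * nat * bool) (h : nat) : Z :=
  let: (a, j, k, s) := t in
  (n * Z.of_nat j + (if s then 1 else -1) * Z.of_nat (a ^ h * k))%Z.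

(** A zero form would make [p0] divide [a ^ h * k], whose factors are positive and below [p0]. Zero
    must be avoided because [omega 0 = 0]. *)
Lemma form_neq0 p0 K n a j k s h : prime p0 -> K < p0 -> 0 < a <= K -> 0 < k <= K ->
  (Z.of_nat p0 | n)%Z -> form n (a, j, k, s) h <> 0%Z.
Proof.
move=> pp Kp /andP[a0 aK] /andP[k0 kK] [w nw] /= f0.
have : (Z.of_nat p0 | Z.of_nat (a ^ h * k))%Z.
  exists (if s then - (w * Z.of_nat j) else w * Z.of_nat j)%Z.
  by move: f0; rewrite nw; case: s; set A := Z.of_nat (a ^ h * k); nia.
move=> /(Z_divide_nat (prime_gt0 pp)); rewrite Euclid_dvdM // Euclid_dvdX //.
by move=> /orP[/andP[/(dvdn_leq a0)]|/(dvdn_leq k0)]; lia.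
Qed.

Lemma form_divide q n a j k s d b h : a ^ d = 1 %[mod q] -> h = b %[mod d] ->
  (Z.of_nat q | form n (a, j, k, s) b)%Z -> (Z.of_nat q | form n (a, j, k, s) h)%Z.
Proof.
move=> ad hb fb.
have E : form n (a, j, k, s) h = (form n (a, j, k, s) b +
    (if s then 1 else -1) * Z.of_nat k * (Z.of_nat (a ^ h) - Z.of_nat (a ^ b)))%Z.
  by rewrite /form !Nat2Z.inj_mul; case: s {fb}; ring.
rewrite E; apply: Z.divide_add_r => //; apply: Z.divide_mul_r.
by apply: Z_divide_eq_mod; apply: expn_eq_mod hb.
Qed.

Definition targets K : seq (nat * nat * nat * bool) :=
  [seq (x, s) | x <- [seq (y, k) | y <- [seq (a, j) | a <- iota 2 K.-1, j <- iota 1 K], k <- iota 1 K],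
                s <- [:: true; false]].

Lemma mem_targets K a j k s :
  ((a, j, k, s) \in targets K) = [&& 1 < a <= K, 0 < j <= K & 0 < k <= K].
Proof.
have memf (A B : eqType) (x : A) (y : B) u v : ((x, y) \in [seq (x, y) | x <- u, y <- v]) = (x \in u) && (y \in v).
  by apply/allpairsP/andP => [[[x' y'] [/= ? ? [-> ->]]]|[? ?]] //; exists (x, y).
rewrite !memf !mem_iota; have -> : s \in [:: true; false] by case: s.
by rewrite andbT -andbA; apply/idP/idP; lia.
Qed.

(** The constant [c] is the number of forms. Repeating the list of targets [m] times asks for [m]
    congruences for each form and exponent, and their moduli are distinct. *)
Lemma exists_residue_class (K : nat) : (2 <= K)%coq_nat ->
  exists c : nat, (1 <= c)%coq_nat /\
  forall m L V : nat, (1 <= V)%coq_nat ->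
  exists (W r : nat) (n0 : Z),
  [/\ (1 <= W)%coq_nat, (Nat.mul r V <= Nat.mul (Nat.mul m c) (S L))%coq_nat,
   (W <= modulus_bound K V (Nat.mul m c) r)%coq_nat &
   forall n, (Z.of_nat W | n - n0)%Z -> forall a j k h,
     (2 <= a)%coq_nat /\ (a <= K)%coq_nat -> (1 <= j)%coq_nat /\ (j <= K)%coq_nat ->
     (1 <= k)%coq_nat /\ (k <= K)%coq_nat -> (h <= L)%coq_nat ->
     (m <= omega (n * Z.of_nat j + Z.of_nat a ^ Z.of_nat h * Z.of_nat k)%Z)%coq_nat /\
     (m <= omega (n * Z.of_nat j - Z.of_nat a ^ Z.of_nat h * Z.of_nat k)%Z)%coq_nat].
Proof.
move=> /leP K1; exists (size (targets K)); split.
  have : (2, 1, 1, true) \in targets K by rewrite mem_targets; lia.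
  by case: (targets K) => // t s _; apply/leP.
move=> m L V /leP V0.
(* All [n] in the class are multiples of [p0 > K], so that no form vanishes. *)
have [p0 [pp0 p0K p0B]] := exists_new_small_prime (iota 0 K.+1).
rewrite size_iota in p0B.
pose base (t : nat * nat * nat * bool) := t.1.1.1.
pose us := flatten (nseq m (targets K)).
have usE t : count_mem t us = m * count_mem t (targets K).
  by rewrite /us; elim: (m) => //= m' IH; rewrite count_cat IH mulSn.
have sus : size us = m * size (targets K).
  by rewrite /us; elim: (m) => //= m' IH; rewrite size_cat IH mulSn.
have usT t : t \in us -> t \in targets K by move=> /flattenP[s]; rewrite mem_nseq => /andP[_ /eqP ->].
have usK t : t \in us -> 1 < base t <= K.
  by move=> /usT; case: t => [[[a j] k] s]; rewrite mem_targets => /and3P[].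
(* Excluding [0, ..., K] makes every [j] invertible modulo the primes chosen. The excluded list has
   [K + 2] entries, whence the [K + 3] in [modulus_bound]. *)
have [G [r [[B [uG PG vG]] cG rV prodG]]] :=
  @covering_system _ base K L V us (p0 :: iota 0 K.+1) (ltnW K1) V0 usK.
rewrite !multE -sus.
(* The guard [target c \in targets K] ensures [0 < j <= K]; for any other target the property is
   vacuous and every residue serves. *)
pose E := (p0, fun n : Z => (Z.of_nat p0 | n)%Z) ::
  [seq (modulus c, fun n => target c \in targets K ->
     (Z.of_nat (modulus c) | form n (target c) (exponent c))%Z) | c <- G].
have E1 : map fst E = p0 :: map modulus G by rewrite /E /= -map_comp.
have inP q : q \in map modulus G -> q \notin p0 :: iota 0 K.+1 by move=> /PG /andP[].
have GIn c : In c G -> modulus c \in map modulus G.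
  by elim: (G) => //= c' G' IH [->|/IH]; rewrite inE ?eqxx // => ->; rewrite orbT.
have primeG : all prime (map modulus G).
  by elim: (G) vG => //= c G' IH vG; rewrite (vG c (or_introl (erefl _))).1 IH // => c' ?; apply: vG; right.
have [|||n0 Hn0] := @chinese_remainder E.
- by rewrite E1 /= uG andbT; apply/negP => /inP; rewrite mem_head.
- by rewrite E1 /= pp0.
- move=> c [<-|/in_map_iff[c' [<- c'G]]]; first by exists 0%Z => n; rewrite Z.sub_0_r.
  case: (boolP (target c' \in targets K)) => [tK|_]; last by exists 0%Z.
  case: (target c') tK => [[[a j] k] s]; rewrite mem_targets => /and3P[_ /andP[j0 jK] _].
  have [|r' Hr'] := @linear_residue (modulus c') j
    ((if s then 1 else -1) * Z.of_nat (a ^ exponent c' * k))%Z (vG c' c'G).1.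
    rewrite j0; have := inP _ (GIn _ c'G); rewrite inE mem_iota negb_or; lia.
  by exists r' => n /= /Hr'.
rewrite E1 in Hn0; exists (\prod_(q <- p0 :: map modulus G) q), r, n0; split.
- apply/leP; rewrite big_seq prodn_cond_gt0 // => q; rewrite inE => /orP[/eqP ->|/(allP primeG)]; move=> *; exact: prime_gt0.
- exact/leP.
- rewrite big_cons big_map /modulus_bound !powE plusE multE addn2 addn3; apply/leP.
  by apply: leq_mul p0B _; move: prodG; rewrite /= size_iota.
move=> n /Hn0 {}Hn0 a j k h [/leP a2 /leP aK] [/leP j1 /leP jK] [/leP k1 /leP kK] /leP hL.
have main s : (m <= omega (form n (a, j, k, s) h))%coq_nat.
  have tK : (a, j, k, s) \in targets K by rewrite mem_targets a2 aK j1 jK k1 kK.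
  have cm : m <= count (covers (a, j, k, s) h) G.
    apply: leq_trans (cG _ _ hL); rewrite usE -{1}[m]muln1 leq_mul2l -has_count has_pred1 tK orbT //.
  (* The prime divisors exhibited are the moduli of the congruences covering this form at [h]. *)
  apply: PeanoNat.Nat.le_trans (elimT leP cm) _; rewrite -size_filter -(size_map (fun c => Z.of_nat (modulus c))).
  apply: omega_ge.
  + apply: (@form_neq0 p0 K) => //; last by apply: (Hn0 _ (or_introl (erefl _))).
    * by move: p0K; rewrite mem_iota; lia.
    * by rewrite (ltnW a2) aK.
    * by rewrite k1 kK.
  + rewrite (map_comp Z.of_nat modulus); apply: FinFun.Injective_map_NoDup; first exact: Nat2Z.inj.
    by apply: uniq_NoDup; rewrite filter_mask map_mask mask_uniq.
  move=> p /in_map_iff[c [<- /filter_In[cG' /andP[/eqP ct /eqP ch]]]].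
  have [pc bc] := vG c cG'; split; first exact: Z_prime.
  have := Hn0 _ (or_intror (in_map _ _ _ cG')); rewrite /= ct => /(_ tK).
  by apply: form_divide ch; move: bc; rewrite ct.
have := main true; have := main false; rewrite /form Nat2Z.inj_mul Z_of_nat_expn.
by rewrite Z.mul_1_l (Z.mul_comm (-1)) -Z.opp_eq_mul_m1 Z.add_opp_r; split.
Qed.

End CoveringCongruences.

(** * Size of the modulus *)

Open Scope R_scope.

Lemma INR_pow_exp (a n : nat) : (1 <= a)%nat -> INR (a ^ n) = exp (INR n * ln (INR a)).
Proof.
  intros a1. assert (0 < INR a) by (apply lt_0_INR; lia).
  rewrite pow_INR, <- Rpower_pow by assumption. reflexivity.
Qed.

Lemma exp_le_mono a b : a <= b -> exp a <= exp b.
Proof. intros [h | ->]; [left; now apply exp_increasing | right; reflexivity]. Qed.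

Lemma exp_ge_self a : a <= exp a.
Proof. pose proof (exp_ineq1_le a); lra. Qed.

(** [exp z] is the cube of [exp (z / 3)]. For [z >= 27 * D] the bound yields
    [exp z >= D * z ^ 2]. *)
Lemma exp_ge_cube z : 0 <= z -> z ^ 3 / 27 <= exp z.
Proof.
  intros z0. replace z with (3 * (z / 3)) at 2 by field.
  replace (3 * (z / 3)) with (z / 3 + (z / 3 + z / 3)) by field.
  rewrite !exp_plus. pose proof (exp_ge_self (z / 3)) as h.
  assert (0 <= z / 3) by lra.
  assert (z / 3 * (z / 3) <= exp (z / 3) * exp (z / 3)) by (apply Rmult_le_compat; lra).
  replace (z ^ 3 / 27) with (z / 3 * (z / 3 * (z / 3))) by field.
  apply Rmult_le_compat; try lra. nra.
Qed.

Lemma nat_above (y : R) : 0 <= y -> exists n : nat, y <= INR n <= y + 1.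
Proof.
  intros y0. destruct (archimed y) as [h1 h2].
  exists (Z.to_nat (up y)).
  rewrite INR_IZR_INZ, Z2Nat.id; [lra | apply le_IZR; lra].
Qed.

Lemma arithmetic_progression_count (x : R) (K W : nat) (n0 : Z) :
  0 < x -> (1 <= K)%nat -> (0 < W)%nat ->
  exists l : list Z, NoDup l /\ INR (length l) >= x / (INR K * INR W) - 1 /\
    forall n, In n l -> (Z.of_nat W | n - n0)%Z /\ x <= IZR n <= (1 + / INR K) * x.
Proof.
  intros x0 K1 W1.
  assert (K0 : 0 < INR K) by (apply lt_0_INR; lia).
  assert (W0 : 0 < INR W) by (apply lt_0_INR; lia).
  (* [s] is the first index whose term exceeds [x], and [T] is the integer part of [x / (K * W)];
     hence the last term is at most [x + W * T <= (1 + / K) * x]. *)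
  set (s := up ((x - IZR n0) / INR W)).
  set (T := (Z.to_nat (up (x / (INR K * INR W))) - 1)%nat).
  assert (q0 : 0 < x / (INR K * INR W)) by (apply Rdiv_lt_0_compat; nra).
  destruct (archimed (x / (INR K * INR W))) as [u1 u2].
  assert (up0 : (1 <= up (x / (INR K * INR W)))%Z).
  { cut (0 < up (x / (INR K * INR W)))%Z; [lia|]. apply lt_IZR; lra. }
  assert (TE : INR T = IZR (up (x / (INR K * INR W))) - 1).
  { unfold T. rewrite minus_INR by lia. rewrite INR_IZR_INZ, Z2Nat.id by lia. simpl; lra. }
  destruct (archimed ((x - IZR n0) / INR W)) as [s1 s2]. fold s in s1, s2.
  exists (map (fun i => n0 + Z.of_nat W * (s + Z.of_nat i))%Z (seq 0 T)). repeat split.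
  - apply FinFun.Injective_map_NoDup; [|apply seq_NoDup].
    intros i i' E. nia.
  - rewrite length_map, length_seq. lra.
  - apply in_map_iff in H as [i [<- _]]. exists (s + Z.of_nat i)%Z; ring.
  - apply in_map_iff in H as [i [<- iT]].
    rewrite plus_IZR, mult_IZR, plus_IZR, <- !INR_IZR_INZ.
    pose proof (pos_INR i).
    assert ((x - IZR n0) / INR W * INR W = x - IZR n0) by (field; lra).
    nra.
  - apply in_map_iff in H as [i [<- iT]]. apply in_seq in iT.
    rewrite plus_IZR, mult_IZR, plus_IZR, <- !INR_IZR_INZ.
    assert (INR i + 1 <= INR T) by (rewrite <- S_INR; apply le_INR; lia).
    assert ((x - IZR n0) / INR W * INR W = x - IZR n0) by (field; lra).
    assert (x / (INR K * INR W) * INR W = / INR K * x) by (field; lra).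
    nra.
Qed.

(** [X], [w], [z] are the first three iterated logarithms of [x]. Each of the three factors of the
    modulus is at most [exp (eps / 8 * X)]. *)
Lemma modulus_bound_le (K m V r c : nat) (X w z eps D : R) :
  (2 <= K)%nat -> (1 <= c)%nat -> X = exp w -> w = exp z -> 0 < eps < 1 -> 1 <= z ->
  w >= D * z ^ 2 ->
  D >= 5 -> D >= 4 * (ln (INR (K + 3)) + 96 * INR c) ->
  D * eps >= 192 * INR c * INR K -> D * eps >= 256 * ln (INR K) ->
  D * eps >= 8 * INR (8 * (K + 2) ^ 2) ->
  (1 <= V)%nat -> INR m <= 2 * z -> INR V <= w ^ 3 ->
  INR r <= 4 * INR c * INR K * z * X / w ^ 2 ->
  INR (modulus_bound K V (m * c) r) <= exp (eps / 2 * X).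
Proof.
  intros K2 c1 EX Ew eps01 z1 wD D5 D1 D2 D3 D4 V1 mz Vw rle.
  assert (zz : z <= z ^ 2) by nra.
  assert (z21 : 1 <= z ^ 2) by nra.
  assert (wDz : w >= D * z) by nra.
  assert (wD1 : w >= D) by nra.
  assert (w5 : 5 <= w) by lra.
  assert (Xw : w <= X) by (rewrite EX; apply exp_ge_self).
  assert (K0 : 2 <= INR K) by (change 2 with (INR 2); apply le_INR; lia).
  assert (c0 : 1 <= INR c) by (change 1 with (INR 1); apply le_INR; lia).
  assert (lnK : 0 < ln (INR K)) by (rewrite <- ln_1; apply ln_increasing; lra).
  set (Y := ((K + 3) * V ^ (16 * (m * c)))%nat).
  (* The logarithm of [Y] is at most [ln (K + 3) + 16 * m * c * ln V], where [m <= 2 * z] and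
     [ln V <= 3 * z]; this is at most [D * z ^ 2 / 4]. *)
  assert (Yle : INR Y <= exp (w / 4)).
  { unfold Y. rewrite mult_INR, INR_pow_exp by lia.
    assert (K3 : 0 < INR (K + 3)) by (apply lt_0_INR; lia).
    rewrite <- (exp_ln (INR (K + 3))) at 1 by assumption.
    rewrite <- exp_plus. apply exp_le_mono.
    assert (V0 : 1 <= INR V) by (change 1 with (INR 1); apply le_INR; lia).
    assert (lnV0 : 0 <= ln (INR V)).
    { rewrite <- ln_1. destruct V0 as [h| <-]; [left; apply ln_increasing; lra | right; reflexivity]. }
    assert (lnV : ln (INR V) <= 3 * z).
    { apply Rle_trans with (ln (w ^ 3)).
      - destruct Vw as [h| ->]; [left; apply ln_increasing; lra | right; reflexivity].
      - rewrite ln_pow by lra. rewrite Ew, ln_exp. simpl; lra. }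
    rewrite !mult_INR. replace (INR 16) with 16 by (simpl; lra).
    assert (INR m * ln (INR V) <= 2 * z * (3 * z)).
    { apply Rmult_le_compat; try assumption. apply pos_INR. }
    assert (16 * (INR m * INR c) * ln (INR V) <= 96 * INR c * z ^ 2).
    { replace (16 * (INR m * INR c) * ln (INR V)) with (16 * INR c * (INR m * ln (INR V))) by ring.
      replace (96 * INR c * z ^ 2) with (16 * INR c * (2 * z * (3 * z))) by ring.
      apply Rmult_le_compat_l; lra. }
    assert (0 <= ln (INR (K + 3))).
    { rewrite <- ln_1. left; apply ln_increasing; [lra|]. change 1 with (INR 1); apply lt_INR; lia. }
    nra. }
  assert (X0 : 0 < X) by lra.
  (* Here [48 = 6 * 8]: the [r] single primes are at most [exp (6 * w)], and [r * (6 * w)] has to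
     stay below [eps / 8 * X]. *)
  assert (rX : INR r <= eps / 48 * (X / w)).
  { apply Rle_trans with (1 := rle).
    replace (4 * INR c * INR K * z * X / w ^ 2) with ((4 * INR c * INR K * z / w) * (X / w)) by (field; lra).
    apply Rmult_le_compat_r; [left; apply Rdiv_lt_0_compat; lra|].
    apply Rmult_le_reg_r with w; [lra|].
    replace (4 * INR c * INR K * z / w * w) with (4 * INR c * INR K * z) by (field; lra).
    assert (D * eps * z <= w * eps) by nra. nra. }
  assert (Xw1 : X / w <= X).
  { apply Rmult_le_reg_r with w; [lra|]. replace (X / w * w) with X by (field; lra). nra. }
  assert (Xw0 : 0 < X / w) by (apply Rdiv_lt_0_compat; lra).
  assert (YX : INR Y <= X).
  { apply Rle_trans with (1 := Yle). rewrite EX. apply exp_le_mono; lra. }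
  assert (Y0 := pos_INR Y). assert (r0 := pos_INR r).
  assert (E1 : INR (8 * (K + 2) ^ 2) <= exp (eps / 8 * X)).
  { apply Rle_trans with (eps / 8 * X); [nra | apply exp_ge_self]. }
  assert (E2 : INR (K ^ (16 * Y * Y)) <= exp (eps / 8 * X)).
  { rewrite INR_pow_exp by lia. apply exp_le_mono.
    rewrite !mult_INR. replace (INR 16) with 16 by (simpl; lra).
    assert (YY : INR Y * INR Y <= exp (w / 2)).
    { replace (w / 2) with (w / 4 + w / 4) by field. rewrite exp_plus. now apply Rmult_le_compat. }
    assert (XE : X = exp (w / 2) * exp (w / 2)) by (rewrite <- exp_plus, EX; f_equal; field).
    assert (128 * ln (INR K) <= eps * exp (w / 2)).
    { pose proof (exp_ge_self (w / 2)). nra. }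
    pose proof (exp_pos (w / 2)).
    apply Rle_trans with (16 * exp (w / 2) * ln (INR K)); [nra|].
    rewrite XE. nra. }
  assert (E3 : INR ((8 * (Y + r) ^ 2) ^ r) <= exp (eps / 8 * X)).
  { rewrite pow_INR, mult_INR, pow_INR, plus_INR.
    replace (INR 8) with 8 by (simpl; lra).
    (* Both [Y] and [r] are at most [X = exp w], and [32 <= exp (4 * w)]. *)
    assert (B : 8 * (INR Y + INR r) ^ 2 <= exp (6 * w)).
    { apply Rle_trans with (32 * X ^ 2).
      - assert (INR Y + INR r <= 2 * X) by nra. nra.
      - replace (6 * w) with (4 * w + (w + w)) by ring. rewrite !exp_plus, <- EX.
        assert (32 <= exp (4 * w)).
        { apply Rle_trans with (exp 20); [|apply exp_le_mono; lra].
          replace 20 with (10 + 10) by ring. rewrite exp_plus.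
          pose proof (exp_ge_self 10). nra. }
        nra. }
    apply Rle_trans with (exp (6 * w) ^ r).
    - apply pow_incr. split; [nra | exact B].
    - rewrite <- Rpower_pow by apply exp_pos. unfold Rpower. rewrite ln_exp.
      apply exp_le_mono.
      assert (INR r * w <= eps / 48 * X).
      { replace (eps / 48 * X) with (eps / 48 * (X / w) * w) by (field; lra).
        apply Rmult_le_compat_r; lra. }
      lra. }
  unfold modulus_bound. fold Y. rewrite (mult_INR (8 * (K + 2) ^ 2)), (mult_INR (K ^ (16 * Y * Y))).
  apply Rle_trans with (exp (eps / 8 * X) * (exp (eps / 8 * X) * exp (eps / 8 * X))).
  - apply Rmult_le_compat; try apply pos_INR; [|exact E1|].
    + apply Rmult_le_pos; apply pos_INR.
    + apply Rmult_le_compat; try apply pos_INR; assumption.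
  - rewrite <- !exp_plus. apply exp_le_mono. nra.
Qed.

(** * Choice of the parameters and count of the integers *)

Theorem theorem1p1 (K : nat) (HK : (2 <= K)%nat) :
  exists eps0 : R, 0 < eps0 /\
  forall eps : R, 0 < eps < eps0 ->
  exists x0 : R, forall x : R, x >= x0 ->
  exists l : list Z, NoDup l /\
    INR (length l) >= Rpower x (1 - eps) /\
    forall n : Z, In n l ->
      (x <= IZR n <= (1 + / INR K) * x) /\
      forall a j k h : nat,
        (2 <= a <= K)%nat -> (1 <= j <= K)%nat -> (1 <= k <= K)%nat ->
        INR h <= INR K * ln x ->
        INR (omega (n * Z.of_nat j + Z.of_nat a ^ Z.of_nat h * Z.of_nat k))
          >= Rpower (ln (ln (ln x))) (1/3 - eps) /\
        INR (omega (n * Z.of_nat j - Z.of_nat a ^ Z.of_nat h * Z.of_nat k))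
          >= Rpower (ln (ln (ln x))) (1/3 - eps).
Proof.
  exists 1. split; [lra|]. intros eps eps01.
  destruct (CoveringCongruences.exists_residue_class HK) as [c [c1 Hc]].
  assert (K0 : 2 <= INR K) by (change 2 with (INR 2); apply le_INR; lia).
  assert (c0 : 1 <= INR c) by (change 1 with (INR 1); apply le_INR; lia).
  assert (lnK : 0 < ln (INR K)) by (rewrite <- ln_1; apply ln_increasing; lra).
  assert (lnK3 : 0 < ln (INR (K + 3))).
  { rewrite <- ln_1. apply ln_increasing; [lra|]. change 1 with (INR 1); apply lt_INR; lia. }
  (* [D] meets all the lower bounds required by [modulus_bound_le]; the term [4 * INR K] serves
     [2 * K <= exp (eps / 2 * X)] below. *)
  set (D := 5 + 4 * (ln (INR (K + 3)) + 96 * INR c) +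
    (192 * INR c * INR K + 256 * ln (INR K) + 8 * INR (8 * (K + 2) ^ 2) + 4 * INR K) / eps).
  set (N := INR (8 * (K + 2) ^ 2)) in D.
  assert (N0 : 0 <= N) by apply pos_INR.
  assert (De : D * eps >= 192 * INR c * INR K + 256 * ln (INR K) + 8 * N + 4 * INR K).
  { unfold D. rewrite Rmult_plus_distr_r. unfold Rdiv.
    rewrite Rmult_assoc, Rinv_l by lra. nra. }
  assert (cK : 0 <= INR c * INR K) by nra.
  assert (D5 : D >= 5 + 4 * (ln (INR (K + 3)) + 96 * INR c)).
  { assert (0 <= (192 * INR c * INR K + 256 * ln (INR K) + 8 * N + 4 * INR K) / eps).
    { apply Rmult_le_pos; [nra | left; apply Rinv_0_lt_compat; lra]. }
    unfold D; lra. }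
  (* Three logarithms turn this threshold into [z >= 27 * D], as [exp_ge_cube] demands. *)
  exists (exp (exp (exp (27 * D)))). intros x xx0.
  assert (x0 : 0 < x) by (pose proof (exp_pos (exp (exp (27 * D)))); lra).
  assert (lnmono : forall u v, 0 < u -> v >= u -> ln v >= ln u).
  { intros u v u0 [h| ->]; [left; now apply ln_increasing | right; reflexivity]. }
  set (X := ln x).
  assert (XX : X >= exp (exp (27 * D))).
  { rewrite <- (ln_exp (exp (exp _))). apply lnmono; [apply exp_pos | exact xx0]. }
  assert (X0 : 0 < X) by (pose proof (exp_pos (exp (27 * D))); lra).
  set (w := ln X).
  assert (ww : w >= exp (27 * D)).
  { rewrite <- (ln_exp (exp _)). apply lnmono; [apply exp_pos | exact XX]. }
  assert (w0 : 0 < w) by (pose proof (exp_pos (27 * D)); lra).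
  set (z := ln w).
  assert (zD : z >= 27 * D).
  { rewrite <- (ln_exp (27 * D)). apply lnmono; [apply exp_pos | exact ww]. }
  assert (Ex : x = exp X) by (unfold X; now rewrite exp_ln).
  assert (EX : X = exp w) by (unfold w; now rewrite exp_ln).
  assert (Ew : w = exp z) by (unfold z; now rewrite exp_ln).
  assert (z1 : 1 <= z) by nra.
  assert (wD : w >= D * z ^ 2).
  { pose proof (exp_ge_cube z ltac:(lra)). rewrite <- Ew in H. nra. }
  assert (w5 : 5 <= w) by nra.
  assert (Xw : w <= X) by (rewrite EX; apply exp_ge_self).
  destruct (nat_above z ltac:(lra)) as [m [m1 m2]].
  destruct (nat_above (w ^ 2) ltac:(nra)) as [V [V1 V2]].
  destruct (nat_above (INR K * X) ltac:(nra)) as [L [L1 L2]].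
  assert (Vpos : (1 <= V)%nat) by (apply INR_le; change (INR 1) with 1; nra).
  destruct (Hc m L V Vpos) as [W [r [n0 [Wpos rV Wle HW]]]].
  assert (bound : INR W <= exp (eps / 2 * X)).
  { apply Rle_trans with (INR (modulus_bound K V (m * c) r)); [now apply le_INR|].
    (* [r <= m c (L + 1) / V <= 2 z c (2 K X) / w^2] *)
    apply modulus_bound_le with (w := w) (z := z) (D := D); try assumption; try (fold N; nra).
    apply le_INR in rV. rewrite !mult_INR, S_INR in rV.
    assert (w2 : 0 < w ^ 2) by nra.
    apply Rmult_le_reg_r with (w ^ 2); [exact w2|].
    replace (4 * INR c * INR K * z * X / w ^ 2 * w ^ 2) with (4 * INR c * INR K * z * X) by (field; lra).
    apply Rle_trans with (INR r * INR V); [apply Rmult_le_compat_l; [apply pos_INR | exact V1]|].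
    apply Rle_trans with (1 := rV).
    replace (4 * INR c * INR K * z * X) with (2 * z * INR c * (2 * (INR K * X))) by ring.
    apply Rmult_le_compat.
    - apply Rmult_le_pos; apply pos_INR.
    - pose proof (pos_INR L); lra.
    - apply Rmult_le_compat_r; lra.
    - assert (2 * 5 <= INR K * X) by (apply Rmult_le_compat; lra). lra. }
  destruct (arithmetic_progression_count x K W n0 x0 ltac:(lia) Wpos) as [l [ul [ll Hl]]].
  exists l. split; [exact ul|]. split.
  - apply Rge_trans with (1 := ll). unfold Rpower. fold X.
    assert (W0 : 0 < INR W) by (apply lt_0_INR; lia).
    set (E := exp ((1 - eps) * X)).
    assert (E1 : 1 <= E) by (unfold E; rewrite <- exp_0 at 1; apply exp_le_mono; nra).
    assert (big : 2 * INR K <= exp (eps / 2 * X)).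
    { pose proof (exp_ge_self (eps / 2 * X)). nra. }
    assert (xE : x = exp (eps / 2 * X) * exp (eps / 2 * X) * E).
    { unfold E. rewrite <- !exp_plus, Ex at 1. f_equal. field. }
    (* [2 * K] and [W] are each at most [exp (eps / 2 * X)]. The spare [E >= 1] absorbs the [- 1] in
       the count. *)
    assert (2 * E <= x / (INR K * INR W)); [|lra].
    apply Rmult_le_reg_r with (INR K * INR W); [nra|].
    replace (x / (INR K * INR W) * (INR K * INR W)) with x by (field; lra).
    rewrite xE. replace (2 * E * (INR K * INR W)) with (2 * INR K * INR W * E) by ring.
    apply Rmult_le_compat_r; [lra|]. apply Rmult_le_compat; lra.
  - intros n nl. destruct (Hl n nl) as [nW nx]. split; [exact nx|].
    intros a j k h a2 j1 k1 hX.
    assert (hL : (h <= L)%nat) by (apply INR_le; fold X in hX; lra).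
    destruct (HW n nW a j k h a2 j1 k1 hL) as [o1 o2].
    (* The construction gives [m >= z] prime factors; as [z >= 1], this exceeds the power with
       exponent [1 / 3 - eps < 1]. *)
    assert (zm : Rpower z (1 / 3 - eps) <= INR m).
    { apply Rle_trans with (Rpower z 1).
      - apply Rle_Rpower; lra.
      - rewrite Rpower_1; lra. }
    fold X w z. split; apply Rle_ge, Rle_trans with (1 := zm), le_INR; assumption.
Qed.
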